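(* Let $n,q,N\in\mathbb{N}$, let $A\in\mathbb{R}^{n\times n}$, $B\in\mathbb{R}^{n\times q}$, and let $f\colon\mathbb{R}^n\times\mathbb{R}^q\to\mathbb{R}^n$ be given by $f(x,u)=Ax+Bu$. Let $g\colon\mathbb{R}^n\to\mathbb{R}$, $\ell_1\colon\mathbb{R}^n\to\mathbb{R}$ and $\ell_2\colon\mathbb{R}^q\to\mathbb{R}$ be $C^2$ functions, and let $\ell\colon\mathbb{R}^n\times\mathbb{R}^q\to\mathbb{R}$. Assume that for all $x\in\mathbb{R}^n$, $u\in\mathbb{R}^q$ it holds that $D^2g(x)\succeq 0$, $D^2\ell_1(x)\succeq 0$, $D^2\ell_2(u)\succ 0$, and $\ell(x,u)=\ell_1(x)+\ell_2(u)$. Let $J\colon\mathbb{R}^n\times\mathbb{R}^{qN}\to\mathbb{R}$ be given by $$J(x,U)=g(x_{U,N})+\sum_{k=0}^{N-1}\ell(x_{U,k},u_k)$$ for $x\in\mathbb{R}^n$ and $U=[u_0^\top\; u_1^\top\cdots u_{N-1}^\top]^\top\in\mathbb{R}^{qN}$ with $u_k\in\mathbb{R}^q$. Then $J$ is $C^2$ and for all $x\in\mathbb{R}^n$, $U\in\mathbb{R}^{qN}$ it holds that $D_U^2J(x,U)\succ 0$.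
   Context: For $x\in\mathbb{R}^n$ and $U=[u_0^\top\cdots u_{N-1}^\top]^\top\in\mathbb{R}^{qN}$, the sequence $(x_{U,k})_{k\in\{0,1,\dots,N\}}$ is the state evolution of the discrete-time system $x^+=f(x,u)$ with initial state $x$ and control input $U$, i.e. $x_{U,0}=x$ and $x_{U,k+1}=f(x_{U,k},u_k)$ for $k=0,\dots,N-1$. $D^2$ denotes the Hessian and $D^2_U$ the Hessian with respect to the variable $U$. For a symmetric matrix $M$, $M\succeq0$ means positive semidefinite and $M\succ0$ means positive definite. *)

(* Defs.v *)
From mathcomp Require Import all_boot all_order all_algebra.
From mathcomp Require Import all_classical all_reals all_analysis.

Set Implicit Arguments.
Unset Strict Implicit.
Unset Printing Implicit Defensive.

Import Order.TTheory GRing.Theory Num.Theory.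
Import numFieldNormedType.Exports.

Local Open Scope ring_scope.

(* Only meant for finite-dimensional [V]: there, the topology of the space of
   linear forms is that of pointwise convergence, so that the Fréchet derivative
   of [f] is of class C^k exactly when all the functions x |-> 'd f x v are.
   With [V] = R^n * R^m this is joint smoothness in both variables. *)
Fixpoint of_class_C (R : realType) (V : normedModType R) (k : nat)
    (f : V -> R) : Prop :=
  if k is k'.+1 then
    (forall x, differentiable f x) /\ (forall v, of_class_C k' ('D_v f))
  else continuous f.

Definition hessian (R : realType) (m : nat) (f : 'cV[R]_m -> R)
    (x : 'cV[R]_m) : 'M[R]_m :=
  \matrix_(i, j) 'D_(delta_mx i 0) ('D_(delta_mx j 0) f) x.

Definition psdmx (R : realType) (m : nat) (M : 'M[R]_m) : Prop :=
  M \is symmetricmx /\ forall v : 'cV[R]_m, 0 <= (v^T *m M *m v) 0 0.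

Definition pdmx (R : realType) (m : nat) (M : 'M[R]_m) : Prop :=
  M \is symmetricmx /\
  forall v : 'cV[R]_m, v != 0 -> 0 < (v^T *m M *m v) 0 0.

Lemma stack_index_subproof (q N : nat) (k : 'I_N) (j : 'I_q) :
  (k * q + j < q * N)%N.
Proof.
rewrite (@leq_trans (k.+1 * q)) //; last by rewrite mulnC leq_mul2l ltn_ord orbT.
by rewrite mulSn addnC ltn_add2r.
Qed.

Definition stack_index (q N : nat) (k : 'I_N) (j : 'I_q) : 'I_(q * N) :=
  Ordinal (stack_index_subproof k j).

(* The block u_k of U = [u_0^T ... u_{N-1}^T]^T. *)
Definition input (R : realType) (q N : nat) (U : 'cV[R]_(q * N)) (k : 'I_N) :
    'cV[R]_q :=
  \col_j U (stack_index k j) 0.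

(* [state f x U k] is x_{U,k} for k <= N; for k > N, where no input is
   available, it stays at x_{U,N}. *)
Fixpoint state (R : realType) (n q N : nat)
    (f : 'cV[R]_n -> 'cV[R]_q -> 'cV[R]_n) (x : 'cV[R]_n)
    (U : 'cV[R]_(q * N)) (k : nat) : 'cV[R]_n :=
  if k is k'.+1 then
    if insub k' is Some i then f (state f x U k') (input U i)
    else state f x U k'
  else x.

Lemma stateS (R : realType) (n q N : nat)
    (f : 'cV[R]_n -> 'cV[R]_q -> 'cV[R]_n) (x : 'cV[R]_n)
    (U : 'cV[R]_(q * N)) (k : 'I_N) :
  state f x U k.+1 = f (state f x U k) (input U k).
Proof. by rewrite /= valK. Qed.

(* Main.v *)
Require Import Defs.
From mathcomp Require Import all_boot all_order all_algebra.
From mathcomp Require Import all_classical all_reals all_analysis.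
Import Order.TTheory GRing.Theory Num.Theory.
Import numFieldNormedType.Exports.
Local Open Scope ring_scope.

(** The states depend linearly on z = (x, U), so (x, U) |-> J x U is a finite sum
    of functions F \o L, where F is g, l1 or l2 and L is a linear map of z (a
    state or an input block).  Two facts about directional derivatives carry the
    proof.

    - If L is affine with linear part T, the difference quotient of F \o L at y
      along v is that of F at L y along T v; hence
      'D_v (F \o L) y = 'D_(T v) F (L y) ([derive_affine]).  By induction on k,
      the class C^k is stable under composition with such an L
      ([of_class_C_affine]); it is also stable under sums, so J is C^2.

    - v^T H w = 'D_v ('D_w F) x when H is the Hessian at x of a C^2 function F
      ([hessianE]).  Symmetry and (semi)definiteness of Hessians thereby become
      statements about iterated directional derivatives, which the previous point
      transports through L.

    For fixed x, J x is the joint cost composed with the affine map U |-> (x, U),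
    whose linear part is V |-> (0, V).  Its second derivative along V is therefore
    a sum of the forms of g and l1, which are nonnegative, and of the forms of l2
    along the blocks of V; a nonzero V has a nonzero block, and the form of l2
    along that block is positive.  Symmetry is inherited from g, l1 and l2 term by
    term. *)

Set Implicit Arguments.
Unset Strict Implicit.
Unset Printing Implicit Defensive.

(** * Directional derivatives through affine maps and sums *)

(** This asserts at once that T is the linear part of L and that L is affine, in
    the form in which L occurs in a difference quotient. *)
Definition affine_with (R : numFieldType) (V W : lmodType R) (L T : V -> W) :=
  forall (h : R) v y, L (h *: v + y) = h *: T v + L y.

(** The difference quotients on the two sides are the same function of the
    increment, so their limits agree. *)
Lemma derive_affine (R : numFieldType) (V W X : normedModType R) (F : W -> X)
    (L T : V -> W) (y v : V) :
  affine_with L T -> 'D_v (F \o L) y = 'D_(T v) F (L y).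
Proof.
by move=> LT; rewrite /derive /= /shift /=; under eq_fun do rewrite LT.
Qed.

Lemma of_class_C_affine (R : realType) (V W : normedModType R)
    (L T : V -> W) (k : nat) (F : W -> R) :
  affine_with L T -> (forall y, differentiable L y) ->
  of_class_C k F -> of_class_C k (F \o L).
Proof.
move=> LT dL; elim: k F => [|k IH] F /=.
  move=> cF y; apply: continuous_comp; last exact: cF.
  exact/differentiable_continuous.
move=> [dF cF]; split=> [y|v]; first exact: differentiable_comp.
rewrite (_ : 'D_v _ = 'D_(T v) F \o L); first exact: IH.
by apply/funext => y; exact: derive_affine.
Qed.

Lemma derive_fctD (R : numFieldType) (V W : normedModType R) (F G : V -> W) v :
  (forall x, differentiable F x) -> (forall x, differentiable G x) ->
  'D_v (F \+ G) = 'D_v F \+ 'D_v G.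
Proof.
move=> dF dG; apply/funext => x.
by apply: deriveD; exact: diff_derivable.
Qed.

Lemma of_class_C_add (R : realType) (V : normedModType R) k (F G : V -> R) :
  of_class_C k F -> of_class_C k G -> of_class_C k (F \+ G).
Proof.
elim: k F G => [|k IH] F G.
  by move=> cF cG x; apply: cvgD; [exact: cF|exact: cG].
move=> cF cG; split=> [x|v] /=.
  by apply: differentiableD; [exact: cF.1|exact: cG.1].
rewrite (derive_fctD v cF.1 cG.1).
by apply: IH; [exact: cF.2|exact: cG.2].
Qed.

Lemma of_class_C_cst (R : realType) (V : normedModType R) k (c : R) :
  of_class_C k (cst c : V -> R).
Proof.
elim: k c => [|k IH] c; first exact: cst_continuous.
split=> [x|v]; first exact: differentiable_cst.
by rewrite (_ : 'D_v _ = cst 0)//; apply/funext => x; exact: derive_cst.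
Qed.

Lemma of_class_C_sum (R : realType) (V : normedModType R) k m
    (F : 'I_m -> V -> R) : (forall i, of_class_C k (F i)) ->
  of_class_C k (fun x => \sum_i F i x).
Proof.
move=> cF; rewrite -fct_sumE.
elim/big_ind: _ => [|G H cG cH|i _]; [exact: of_class_C_cst| |exact: cF].
exact: of_class_C_add.
Qed.

Lemma derive2_affine (R : realType) (V W : normedModType R)
    (L T : V -> W) (F : W -> R) (y v w : V) :
  affine_with L T ->
  'D_v ('D_w (F \o L)) y = 'D_(T v) ('D_(T w) F) (L y).
Proof.
move=> LT; rewrite -(derive_affine _ y v LT); congr ('D_v _ y).
by apply/funext => z; exact: derive_affine.
Qed.

Lemma derive2D (R : realType) (V : normedModType R) (F G : V -> R) x v w :
  of_class_C 2 F -> of_class_C 2 G ->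
  'D_v ('D_w (F \+ G)) x = 'D_v ('D_w F) x + 'D_v ('D_w G) x.
Proof.
move=> cF cG; rewrite (derive_fctD w cF.1 cG.1).
by apply: deriveD; apply/diff_derivable; [exact: (cF.2 w).1|exact: (cG.2 w).1].
Qed.

Lemma derive2_sum (R : realType) (V : normedModType R) m
    (F : 'I_m -> V -> R) x v w : (forall i, of_class_C 2 (F i)) ->
  'D_v ('D_w (fun y => \sum_i F i y)) x = \sum_i 'D_v ('D_w (F i)) x.
Proof.
move=> cF.
rewrite -fct_sumE.
have -> : 'D_w (\sum_i F i) = \sum_i 'D_w (F i).
  apply/funext => y; rewrite derive_sum ?fct_sumE// => i.
  exact/diff_derivable/(cF i).1.
by rewrite derive_sum// => i; exact/diff_derivable/((cF i).2 w).1.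
Qed.

(** * Differentiability of matrix-valued functions *)

(** A matrix is the sum of its entries times the fixed matrices [delta_mx i j],
    so entrywise differentiability suffices. *)
Lemma differentiable_mx (R : realType) (V : normedModType R) m n
    (F : V -> 'M[R]_(m, n)) x :
  (forall i j, differentiable (fun y => F y i j) x) -> differentiable F x.
Proof.
move=> dF.
rewrite (_ : F = \sum_i \sum_j (fun y => F y i j *: delta_mx i j)).
  apply: differentiable_sum => i; apply: differentiable_sum => j.
  exact: differentiableZl.
apply/funext => y; rewrite {1}[F y]matrix_sum_delta fct_sumE.
by apply: eq_bigr => i _; rewrite fct_sumE.
Qed.

Lemma differentiable_mulmx (R : realType) (V : normedModType R) m n p
    (M : 'M[R]_(m, n)) (F : V -> 'M[R]_(n, p)) x :
  differentiable F x -> differentiable (fun y => M *m F y) x.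
Proof.
move=> dF; apply: differentiable_mx => i j.
rewrite (_ : (fun _ => _) = \sum_k (M i k \*: (fun y => F y k j))).
  apply: differentiable_sum => k; apply: differentiableZ.
  exact: (differentiable_comp dF (differentiable_coord _ _ _)).
by apply/funext => y; rewrite mxE fct_sumE.
Qed.

(** * Hessians as iterated directional derivatives *)

Lemma derive_coord (R : realType) m (F : 'cV[R]_m -> R) x v :
  differentiable F x ->
  'D_v F x = \sum_i v i 0 * 'D_(delta_mx i 0) F x.
Proof.
move=> dF; rewrite deriveE// {1}[v]matrix_sum_delta linear_sum.
by apply: eq_bigr => i _; rewrite big_ord1 linearZ deriveE.
Qed.

(** Expand 'D_w F in coordinates as a function, then differentiate each
    partial derivative along v; the inner and outer expansions give the columns
    and rows of the Hessian respectively. *)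
Lemma hessianE (R : realType) m (F : 'cV[R]_m -> R) x v w : of_class_C 2 F ->
  (v^T *m hessian F x *m w) 0 0 = 'D_v ('D_w F) x.
Proof.
move=> [dF cF].
have -> : 'D_w F = \sum_j w j 0 \*: 'D_(delta_mx j 0) F.
  by apply/funext => y; rewrite derive_coord// fct_sumE.
rewrite derive_sum => [|j]; last first.
  by apply/derivableZ/diff_derivable; have [] := cF (delta_mx j 0).
rewrite mxE; apply: eq_bigr => j _.
have [dFj _] := cF (delta_mx j 0).
rewrite deriveZ; last exact: diff_derivable.
rewrite derive_coord// mxE mulrC; congr (_ * _).
by apply: eq_bigr => i _; rewrite !mxE.
Qed.

Lemma symmetricmxP (R : realType) m (M : 'M[R]_m) :
  reflect (M^T = M) (M \is symmetricmx).
Proof.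
apply: (iffP (is_hermitianmxP _ _ _)).
  by rewrite /= expr0 scale1r map_mx_id.
by rewrite /= expr0 scale1r map_mx_id.
Qed.

(** The entries of the Hessian are the values of the form of [hessianE] on basis
    vectors; this lets symmetry be transported from term to term as a property of
    forms. *)
Lemma symmetric_hessianP (R : realType) m (F : 'cV[R]_m -> R) x :
  of_class_C 2 F ->
  (hessian F x \is symmetricmx) <->
  forall v w, 'D_v ('D_w F) x = 'D_w ('D_v F) x.
Proof.
move=> F2; split=> [/symmetricmxP sH v w|sF].
  rewrite -(hessianE x v w F2) -(hessianE x w v F2).
  rewrite -[in LHS](trmxK (_ *m w)) mxE.
  by rewrite !trmx_mul sH trmxK mulmxA.
by apply/symmetricmxP/matrixP => i j; rewrite !mxE.
Qed.

(** * Linearity of the trajectories *)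

Lemma input_linear (R : realType) (q N : nat) (k : 'I_N) (h : R)
    (U V : 'cV[R]_(q * N)) :
  input (h *: U + V) k = h *: input U k + input V k.
Proof. by apply/colP => j; rewrite !mxE. Qed.

(** Linearity is joint in the initial state and the input; for fixed x the
    states are only affine in U. *)
Lemma state_linear (R : realType) (n q N : nat) (A : 'M[R]_n)
    (B : 'M[R]_(n, q)) (f : 'cV[R]_n -> 'cV[R]_q -> 'cV[R]_n)
    (k : nat) (h : R) (z z' : 'cV[R]_n * 'cV[R]_(q * N)) :
  (forall x u, f x u = A *m x + B *m u) ->
  state f (h *: z + z').1 (h *: z + z').2 k =
  h *: state f z.1 z.2 k + state f z'.1 z'.2 k.
Proof.
move=> f_def; elim: k => //= k; case: insub => [i|//] ->.
by rewrite !f_def input_linear !mulmxDr -!scalemxAr scalerDr addrACA.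
Qed.

Lemma differentiable_input (R : realType) (n q N : nat) (k : 'I_N)
    (z : 'cV[R]_n * 'cV[R]_(q * N)) :
  differentiable (fun z : 'cV[R]_n * 'cV[R]_(q * N) => input z.2 k) z.
Proof.
apply: differentiable_mx => i j.
rewrite (_ : (fun _ => _) =
    (fun U : 'cV[R]_(q * N) => U (stack_index k i) 0) \o snd).
  apply: differentiable_comp; last exact: differentiable_coord.
  by apply: linear_differentiable => y; exact: cvg_snd.
by apply/funext => y; rewrite mxE.
Qed.

Lemma differentiable_state (R : realType) (n q N : nat) (A : 'M[R]_n)
    (B : 'M[R]_(n, q)) (f : 'cV[R]_n -> 'cV[R]_q -> 'cV[R]_n)
    (k : nat) (z : 'cV[R]_n * 'cV[R]_(q * N)) :
  (forall x u, f x u = A *m x + B *m u) ->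
  differentiable (fun z : 'cV[R]_n * 'cV[R]_(q * N) => state f z.1 z.2 k) z.
Proof.
move=> f_def; elim: k => [|k IH] /=.
  by apply: linear_differentiable => y; exact: cvg_fst.
case: insub => [i|//].
under eq_fun do rewrite f_def.
by apply: differentiableD; apply: differentiable_mulmx => //;
  exact: differentiable_input.
Qed.

(** Entry i of U is entry i mod q of block i / q. *)
Lemma input_neq0 (R : realType) (q N : nat) (U : 'cV[R]_(q * N)) :
  U != 0 -> exists k : 'I_N, input U k != 0.
Proof.
move=> U0; apply/existsP; apply: contraNT U0; rewrite negb_exists => /forallP U0.
apply/eqP/colP => i; rewrite mxE.
have q0 : (0 < q)%N by case: (posnP q) i => [-> []//|].
have kN : (i %/ q < N)%N by rewrite ltn_divLR// [X in (_ < X)%N]mulnC.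
have := U0 (Ordinal kN); rewrite negbK => /eqP/colP/(_ (Ordinal (ltn_pmod i q0))).
rewrite !mxE => <-; congr (U _ 0); apply/val_inj => /=.
exact: divn_eq.
Qed.

(** * Second derivative of the cost *)

Theorem proposition3p3 (R : realType) (n q N : nat)
    (A : 'M[R]_n) (B : 'M[R]_(n, q))
    (f : 'cV[R]_n -> 'cV[R]_q -> 'cV[R]_n)
    (f_def : forall x u, f x u = A *m x + B *m u)
    (g l1 : 'cV[R]_n -> R) (l2 : 'cV[R]_q -> R)
    (l : 'cV[R]_n -> 'cV[R]_q -> R)
    (g_C2 : of_class_C 2 g) (l1_C2 : of_class_C 2 l1) (l2_C2 : of_class_C 2 l2)
    (g_psd : forall x, psdmx (hessian g x))
    (l1_psd : forall x, psdmx (hessian l1 x))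
    (l2_pd : forall u, pdmx (hessian l2 u))
    (l_def : forall x u, l x u = l1 x + l2 u)
    (J : 'cV[R]_n -> 'cV[R]_(q * N) -> R)
    (J_def : forall x U,
      J x U = g (state f x U N)
              + \sum_(k < N) l (state f x U k) (input U k)) :
  of_class_C 2 (fun z : 'cV[R]_n * 'cV[R]_(q * N) => J z.1 z.2) /\
  (forall x U, pdmx (hessian (J x) U)).
Proof.
pose Z : normedModType R := ('cV[R]_n * 'cV[R]_(q * N))%type.
pose S k (z : Z) := state f z.1 z.2 k.
pose u (k : 'I_N) (z : Z) := input z.2 k.
have SP k : affine_with (S k) (S k).
  by move=> h z z'; exact: state_linear f_def.
have uP k : affine_with (u k) (u k).
  by move=> h z z'; exact: input_linear.
have dS k z : differentiable (S k) z by exact: differentiable_state f_def.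
have du k z : differentiable (u k) z by exact: differentiable_input.
pose stage (k : 'I_N) := (l1 \o S k) \+ (l2 \o u k).
have l1S_C2 k : of_class_C 2 (l1 \o S k).
  exact: of_class_C_affine (SP k) (dS k) _.
have l2u_C2 k : of_class_C 2 (l2 \o u k).
  exact: of_class_C_affine (uP k) (du k) _.
have stage_C2 k : of_class_C 2 (stage k) by exact: of_class_C_add.
have gS_C2 : of_class_C 2 (g \o S N).
  exact: of_class_C_affine (SP N) (dS N) _.
pose Jz := (g \o S N) \+ (fun z => \sum_(k < N) stage k z).
have sum_C2 := of_class_C_sum stage_C2.
have Jz_C2 : of_class_C 2 Jz by exact: of_class_C_add.
have JzE : (fun z => J z.1 z.2) = Jz.
  apply/funext => z; rewrite J_def; congr (_ + _).
  by apply: eq_bigr => k _; rewrite l_def.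
split=> [|x U]; first by rewrite JzE.
have pairP : affine_with (pair x : 'cV[R]_(q * N) -> Z) (pair 0).
  by move=> h V U'; congr pair; rewrite /= scaler0 add0r.
have JxE : J x = Jz \o pair x.
  by rewrite -JzE; apply/funext.
have Jx_C2 : of_class_C 2 (J x).
  rewrite JxE; apply: (of_class_C_affine pairP) => // y.
  by apply: differentiable_pair.
pose qN v w : R := 'D_(S N (0, v)) ('D_(S N (0, w)) g) (S N (x, U)).
pose q1 k v w : R := 'D_(S k (0, v)) ('D_(S k (0, w)) l1) (S k (x, U)).
pose q2 k v w : R := 'D_(input v k) ('D_(input w k) l2) (input U k).
have D2J v w :
    'D_v ('D_w (J x)) U = qN v w + \sum_(k < N) (q1 k v w + q2 k v w) :> R.
  rewrite JxE (derive2_affine Jz U v w pairP).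
  rewrite (derive2D (x, U) (0, v) (0, w) gS_C2 sum_C2).
  rewrite (derive2_affine g _ _ _ (SP N)) derive2_sum//; congr (_ + _).
  apply: eq_bigr => k _.
  rewrite (derive2D _ _ _ (l1S_C2 k) (l2u_C2 k)).
  by rewrite (derive2_affine l1 _ _ _ (SP k)) (derive2_affine l2 _ _ _ (uP k)).
have qNC v w : qN v w = qN w v.
  exact: (symmetric_hessianP _ g_C2).1 (g_psd _).1 _ _.
have q1C k v w : q1 k v w = q1 k w v.
  exact: (symmetric_hessianP _ l1_C2).1 (l1_psd _).1 _ _.
have q2C k v w : q2 k v w = q2 k w v.
  exact: (symmetric_hessianP _ l2_C2).1 (l2_pd _).1 _ _.
have qN_ge0 v : 0 <= qN v v.
  by rewrite /qN -hessianE//; exact: (g_psd _).2.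
have q1_ge0 k v : 0 <= q1 k v v.
  by rewrite /q1 -hessianE//; exact: (l1_psd _).2.
have q2_gt0 k v : input v k != 0 -> 0 < q2 k v v.
  by rewrite /q2 -hessianE//; exact: (l2_pd _).2.
have q2_ge0 k v : 0 <= q2 k v v.
  have [vk0|/q2_gt0/ltW//] := eqVneq (input v k) 0.
  by rewrite /q2 vk0 derive0.
(* From here on, only the symmetry and the signs of the three forms matter. *)
clearbody qN q1 q2.
split.
  apply: (symmetric_hessianP U Jx_C2).2 => v w.
  rewrite [LHS]D2J [RHS]D2J qNC.
  by under eq_bigr do rewrite q1C q2C.
move=> v /input_neq0[k vk0].
rewrite (hessianE U v v Jx_C2) D2J ltr_wpDl//.
rewrite (bigD1 k)//= ltr_pwDl// ?ltr_wpDl ?q2_gt0//.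
by apply: sumr_ge0 => i _; exact: addr_ge0.
Qed.
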